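(* Let $d_1,d_2$ be positive integers and let $\Phi:L(H_{d_1})\to L(H_{d_2})$ be the linear map with $\Phi(\Gamma_\alpha)=\sum_{\beta=0}^{d_2^2-1}R_{\beta\alpha}\Omega_\beta$ for $\alpha=0,\dots,d_1^2-1$, where $R$ is a real $d_2^2\times d_1^2$ matrix written in block form as $R=\begin{pmatrix}R_{00}&\mathbf{s}\\ \mathbf{t}&\Lambda\end{pmatrix}$ with $R_{00}\in\mathbb{R}$, $\mathbf{s}\in\mathbb{R}^{d_1^2-1}$ (a row), $\mathbf{t}\in\mathbb{R}^{d_2^2-1}$ (a column) and $\Lambda$ a real $(d_2^2-1)\times(d_1^2-1)$ matrix. If $$\sqrt{d_2-1}\,\|\mathbf{t}\|+\sqrt{d_1-1}\,\|\mathbf{s}\|+\sqrt{(d_1-1)(d_2-1)}\,\|\Lambda\|_\infty\le R_{00},$$ then $\Phi$ is a positive map.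
   Context: $H_d$ is the complex Hilbert space of dimension $d$ and $L(H_d)$ is the space of linear operators on it, with Hilbert–Schmidt inner product $\langle A,B\rangle=\operatorname{Tr}(AB^\dagger)$. $\{\Gamma_0=I_{d_1}/\sqrt{d_1},\Gamma_1,\dots,\Gamma_{d_1^2-1}\}$ is a fixed orthonormal basis of $L(H_{d_1})$ consisting of Hermitian operators, with $\Gamma_i$ traceless for $i\ge1$; $\{\Omega_0=I_{d_2}/\sqrt{d_2},\Omega_1,\dots,\Omega_{d_2^2-1}\}$ is a fixed orthonormal basis of $L(H_{d_2})$ consisting of Hermitian operators, with $\Omega_k$ traceless for $k\ge1$. $\|\mathbf{s}\|,\|\mathbf{t}\|$ are Euclidean norms and $\|\Lambda\|_\infty$ is the operator norm (largest singular value) of $\Lambda$. A linear map $\Phi:L(H_{d_1})\to L(H_{d_2})$ is positive if it sends positive semidefinite operators to positive semidefinite operators. *)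

(* Defs.v *)
From HB Require Import structures.
From mathcomp Require Import all_boot all_order all_algebra.
From mathcomp Require Import complex.
From mathcomp Require Import classical_sets reals.

Set Implicit Arguments.
Unset Strict Implicit.
Unset Printing Implicit Defensive.

Import Order.TTheory GRing.Theory Num.Theory.

Local Open Scope ring_scope.
Local Open Scope sesquilinear_scope.
Local Open Scope classical_set_scope.

Definition hs_inner (R : realType) (d : nat) (A B : 'M[R[i]]_d) : R[i] :=
  \tr (A *m B ^t*).

(* The index set {0, ..., d^2 - 1} is written 'I_(1 + (d ^ 2 - 1)), so that it
   matches the 1 + (d^2 - 1) block decomposition of the matrix of a map. *)
Record hermitian_basis (R : realType) (d : nat)
    (G : 'I_(1 + (d ^ 2 - 1)) -> 'M[R[i]]_d) : Prop := HermitianBasis {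
  hb_basis : basis_of fullv [tuple G a | a < 1 + (d ^ 2 - 1)];
  hb_orthonormal : forall a b, hs_inner (G a) (G b) = (a == b)%:R;
  hb_hermitian : forall a, G a \is hermsymmx;
  hb_id : G ord0 = (sqrtC d%:R)^-1 *: 1%:M;
  hb_traceless : forall a, a != ord0 -> \tr (G a) = 0
}.

(* In R[i], 0 <= z means that z is real and nonnegative. *)
Definition psd (R : realType) (d : nat) (A : 'M[R[i]]_d) : Prop :=
  A \is hermsymmx /\ forall v : 'cV[R[i]]_d, 0 <= (v ^t* *m A *m v) 0 0.

Definition positive_map (R : realType) (d1 d2 : nat)
    (Phi : 'M[R[i]]_d1 -> 'M[R[i]]_d2) : Prop :=
  forall A : 'M[R[i]]_d1, psd A -> psd (Phi A).

(* The norm `|v| that MathComp-Analysis puts on matrices is the maximum norm,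
   hence the explicit Euclidean norm. *)
Definition enorm (R : realType) (n : nat) (v : 'cV[R]_n) : R :=
  Num.sqrt (\sum_i v i 0 ^+ 2).

(* The set is bounded and contains 0, also when m = 0 or n = 0, in which case
   the norm is 0. *)
Definition opnorm (R : realType) (m n : nat) (L : 'M[R]_(m, n)) : R :=
  sup [set enorm (L *m x) | x in [set x : 'cV[R]_n | enorm x <= 1]].

(* Main.v *)
(** The coordinates of a positive semidefinite operator A in a Hermitian basis
    are real and lie in a cone: since Tr(A^2) <= (Tr A)^2, the traceless part x
    satisfies |x| <= sqrt(d - 1) x0. The number <v, Phi(A) v> is the
    Hilbert-Schmidt product of Phi(A) with the rank one operator v v^*, whose
    coordinates lie in the cone of dimension d2, so the claim reduces to the
    nonnegativity of a real bilinear form on the product of two cones, which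
    follows from the Cauchy-Schwarz inequality. *)

Require Import Defs.
From mathcomp Require Import all_boot all_order all_algebra.
From mathcomp Require Import complex.
From mathcomp Require Import classical_sets reals.
From mathcomp Require Import ring lra.

Import Order.TTheory GRing.Theory Num.Theory.

Local Open Scope ring_scope.
Local Open Scope complex_scope.
Local Open Scope sesquilinear_scope.

(** * Euclidean and operator norms, and a bilinear form on two cones *)

Lemma sqr_enorm (R : realType) n (x : 'cV[R]_n) :
  enorm x ^+ 2 = \sum_i x i 0 ^+ 2.
Proof. by rewrite sqr_sqrtr// sumr_ge0// => i _; rewrite sqr_ge0. Qed.

Lemma enorm_ge0 (R : realType) n (x : 'cV[R]_n) : 0 <= enorm x.
Proof. exact: sqrtr_ge0. Qed.

Lemma enormZ (R : realType) n (a : R) (x : 'cV[R]_n) :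
  enorm (a *: x) = `|a| * enorm x.
Proof.
rewrite -sqrtr_sqr -sqrtrM ?sqr_ge0// mulr_sumr; congr Num.sqrt.
by apply: eq_bigr => i _; rewrite mxE exprMn.
Qed.

Lemma enorm0 (R : realType) n : enorm (0 : 'cV[R]_n) = 0.
Proof. by rewrite /enorm big1 ?sqrtr0// => i _; rewrite mxE expr0n. Qed.

Lemma enorm_eq0 (R : realType) n (x : 'cV[R]_n) : (enorm x == 0) = (x == 0).
Proof.
apply/eqP/eqP => [x0|->]; last exact: enorm0.
have := sqr_enorm _ _ x; rewrite x0 expr0n => /esym/eqP.
rewrite psumr_eq0 => [/allP h|i _]; last exact: sqr_ge0.
apply/matrixP => i j; rewrite ord1 mxE; apply/eqP.
by rewrite -sqrf_eq0; exact: (implyP (h i (mem_index_enum i))).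
Qed.

Lemma enorm_cauchy_schwarz (R : realType) n (x y : 'cV[R]_n) :
  `|(x^T *m y) 0 0| <= enorm x * enorm y.
Proof.
set c := (_ *m _) 0 0.
have cE : c = \sum_i x i 0 * y i 0.
  by rewrite /c mxE; apply: eq_bigr => i _; rewrite mxE.
have [y0|y0] := eqVneq (enorm y) 0.
  have /eqP yE : y == 0 by rewrite -enorm_eq0 y0.
  by rewrite cE yE big1 ?normr0 ?mulr_ge0 ?enorm_ge0// => i _; rewrite mxE mulr0.
rewrite -ler_sqr ?nnegrE ?mulr_ge0 ?enorm_ge0 ?normr_ge0//.
rewrite real_normK ?num_real// exprMn.
have y_gt0 : 0 < enorm y ^+ 2 by rewrite exprn_gt0// lt_def y0 enorm_ge0.
(* This is the squared norm of |y|^2 x - c y, a multiple of the part of x orthogonal to y. *)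
have: 0 <= \sum_i (enorm y ^+ 2 * x i 0 - c * y i 0) ^+ 2.
  by apply: sumr_ge0 => i _; rewrite sqr_ge0.
have -> : \sum_i (enorm y ^+ 2 * x i 0 - c * y i 0) ^+ 2 =
    enorm y ^+ 2 * (enorm x ^+ 2 * enorm y ^+ 2 - c ^+ 2).
  transitivity (enorm y ^+ 2 ^+ 2 * (\sum_i x i 0 ^+ 2)
      - 2 * enorm y ^+ 2 * c * (\sum_i x i 0 * y i 0)
      + c ^+ 2 * \sum_i y i 0 ^+ 2); last by rewrite -cE -!sqr_enorm; ring.
  rewrite !mulr_sumr -sumrB -big_split/=.
  by apply: eq_bigr => i _; ring.
by rewrite pmulr_rge0// subr_ge0.
Qed.

(** This makes the supremum in [opnorm] finite. The constant is the Frobenius norm of [L], by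
    Cauchy-Schwarz on each row. *)
Lemma enorm_mulmx_bounded (R : realType) m n (L : 'M[R]_(m, n)) :
  exists K, forall x : 'cV[R]_n, enorm (L *m x) <= K * enorm x.
Proof.
exists (Num.sqrt (\sum_i enorm (row i L)^T ^+ 2)) => x.
rewrite -ler_sqr ?nnegrE ?mulr_ge0 ?enorm_ge0 ?sqrtr_ge0//.
rewrite exprMn sqr_enorm sqr_sqrtr ?sumr_ge0// => [|i _]; last exact: sqr_ge0.
rewrite mulr_suml ler_sum// => i _.
have := enorm_cauchy_schwarz _ _ (row i L)^T x.
rewrite trmxK -row_mul mxE -[X in is_true X -> _]ler_sqr ?nnegrE ?mulr_ge0 ?enorm_ge0//.
by rewrite real_normK ?num_real// exprMn.
Qed.

Lemma enorm_mulmx_le_opnorm (R : realType) m n (L : 'M[R]_(m, n))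
    (x : 'cV[R]_n) : enorm x <= 1 -> enorm (L *m x) <= opnorm L.
Proof.
move=> x1; apply: ub_le_sup; last by exists x.
have [K hK] := enorm_mulmx_bounded _ _ _ L.
(* The sign of [K] is not known, so the upper bound on the unit ball is its absolute value. *)
exists `|K| => _ [z /= z1 <-]; apply: le_trans (hK z) _.
apply: le_trans (ler_wpM2r (enorm_ge0 _ _ z) (ler_norm K)) _.
by rewrite ler_piMr.
Qed.

Lemma opnorm_ge0 (R : realType) m n (L : 'M[R]_(m, n)) : 0 <= opnorm L.
Proof.
apply: le_trans (enorm_ge0 _ _ (L *m 0)) _.
by rewrite enorm_mulmx_le_opnorm// enorm0.
Qed.

Lemma enorm_mulmx_le (R : realType) m n (L : 'M[R]_(m, n)) (x : 'cV[R]_n) :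
  enorm (L *m x) <= opnorm L * enorm x.
Proof.
have [/eqP|x0] := eqVneq (enorm x) 0.
  by rewrite enorm_eq0 => /eqP ->; rewrite mulmx0 !enorm0 mulr0.
have x_gt0 : 0 < enorm x by rewrite lt_def x0 enorm_ge0.
have normV : `|(enorm x)^-1| = (enorm x)^-1 by rewrite ger0_norm// invr_ge0 ltW.
rewrite -ler_pdivrMr// mulrC -normV -enormZ scalemxAr.
by rewrite enorm_mulmx_le_opnorm// enormZ normV mulVf.
Qed.

(** By Cauchy-Schwarz the three terms other than r x0 y0 are at least -a |u| x0 y0, -b |t| x0 y0 and
    -a b |L| x0 y0. The last hypothesis, multiplied by x0 y0, says that r x0 y0 outweighs them. *)
Lemma block_form_ge0 (R : realType) m n (a b r : R) (u : 'cV[R]_n)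
    (t : 'cV[R]_m) (L : 'M[R]_(m, n)) (x0 y0 : R) (x : 'cV[R]_n) (y : 'cV[R]_m) :
  0 <= a -> 0 <= b -> 0 <= x0 -> 0 <= y0 ->
  enorm x <= a * x0 -> enorm y <= b * y0 ->
  b * enorm t + a * enorm u + a * b * opnorm L <= r ->
  0 <= y0 * (r * x0 + (u^T *m x) 0 0) + ((y^T *m t) 0 0 * x0 + (y^T *m (L *m x)) 0 0).
Proof.
move=> a0 b0 x00 y00 hx hy hr.
have L0 := opnorm_ge0 _ _ _ L.
have /ler_normlP[h1 _] := enorm_cauchy_schwarz _ _ u x.
have /ler_normlP[h2 _] := enorm_cauchy_schwarz _ _ y t.
have /ler_normlP[h3 _] := enorm_cauchy_schwarz _ _ y (L *m x).
have k1 : enorm u * enorm x <= enorm u * (a * x0) by rewrite ler_wpM2l ?enorm_ge0.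
have k2 : enorm y * enorm t <= b * y0 * enorm t by rewrite ler_wpM2r ?enorm_ge0.
have k3 : enorm y * enorm (L *m x) <= b * y0 * (opnorm L * (a * x0)).
  rewrite ler_pM ?enorm_ge0// (le_trans (enorm_mulmx_le _ _ _ L x))//.
  by rewrite ler_wpM2l.
have l1 : - (y0 * (u^T *m x) 0 0) <= y0 * (enorm u * (a * x0)).
  by rewrite -mulrN ler_wpM2l// (le_trans h1).
have l2 : - ((y^T *m t) 0 0 * x0) <= b * y0 * enorm t * x0.
  by rewrite -mulNr ler_wpM2r// (le_trans h2).
have l3 := le_trans h3 k3.
have := ler_wpM2l (mulr_ge0 x00 y00) hr.
lra.
Qed.

(** * Quadratic forms and positive semidefinite operators *)

Lemma bilinear_form2 (K : comPzRingType) n (A : 'M[K]_n) i j (a b c e : K) :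
  ((a *: delta_mx 0 i + b *: delta_mx 0 j : 'rV_n) *m A *m
   (c *: delta_mx i 0 + e *: delta_mx j 0 : 'cV_n)) 0 0 =
  a * c * A i i + a * e * A i j + b * c * A j i + b * e * A j j.
Proof.
have entry k l : (delta_mx 0 k *m A *m delta_mx l 0 : 'M_1) 0 0 = A k l.
  by rewrite -rowE -colE !mxE.
rewrite !mulmxDl !mulmxDr -!scalemxAl -!scalemxAr !scalerA.
rewrite -(entry i i) -(entry i j) -(entry j i) -(entry j j).
(* The four products are generalized so that [mxE] unfolds only the sums and the scalings. *)
move: (_ *m _ *m delta_mx i 0) (_ *m _ *m delta_mx j 0) => X Y.
move: (_ *m _ *m delta_mx i 0) (_ *m _ *m delta_mx j 0) => Z W.
by rewrite !mxE addrA.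
Qed.

Section Psd.
Context (R : realType) (d : nat).
Implicit Types A B : 'M[R[i]]_d.

Lemma hermsymmxP A : reflect (A ^t* = A) (A \is hermsymmx).
Proof.
by rewrite is_hermitianmxE expr0 scale1r eq_sym; apply: eqP.
Qed.

Lemma hermsymmxC A i j : A \is hermsymmx -> A j i = (A i j)^*%R.
Proof. by move/hermsymmxP => {1}<-; rewrite !mxE. Qed.

Lemma quad_form2 A i j (a b : R[i]) :
  let v := a *: delta_mx i 0 + b *: delta_mx j 0 : 'cV_d in
  (v ^t* *m A *m v) 0 0 =
    a^*%R * a * A i i + a^*%R * b * A i j + b^*%R * a * A j i + b^*%R * b * A j j.
Proof.
rewrite /= [(_ + _)^T]linearD/= map_mxD ![(_ *: _)^T]linearZ/= !map_mxZ/= !trmx_delta !map_delta_mx.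
exact: bilinear_form2.
Qed.

Lemma psd_diag_ge0 A i : psd A -> 0 <= A i i.
Proof.
move=> [_ /(_ (1 *: delta_mx i 0 + 0 *: delta_mx i 0))].
by rewrite quad_form2 conjC0 conjC1 !mulr0 !mul0r !mulr1 mul1r !addr0.
Qed.

(** Principal minors of order 2 are nonnegative: it suffices to test the quadratic form on vectors
    supported on the coordinates i and j. *)
Lemma psd_minor2_le A i j : psd A -> A i j * A j i <= A i i * A j j.
Proof.
move=> pA; have p0 := psd_diag_ge0 _ i pA; have q0 := psd_diag_ge0 _ j pA.
case: pA => hA pA; rewrite (hermsymmxC _ i j hA).
have n0 : 0 <= A i j * (A i j)^*%R by exact: mul_conjC_ge0.
(* The quadratic form at a e_i - b z^* e_j, where z = A_ij. *)
have key (a b : R[i]) : 0 <= a -> 0 <= b ->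
    0 <= a ^+ 2 * A i i - a * b * (A i j * (A i j)^*%R) *+ 2
         + b ^+ 2 * (A i j * (A i j)^*%R) * A j j.
  move=> /ger0_real/CrealP ra /ger0_real/CrealP rb.
  have := pA (a *: delta_mx i 0 + (- b * (A i j)^*%R) *: delta_mx j 0).
  rewrite quad_form2 (hermsymmxC _ i j hA) rmorphM rmorphN/= conjCK ra rb.
  by congr (0 <= _); ring.
have [qE|q_neq0] := eqVneq (A j j) 0.
  (* With n = |A_ij|^2 and p = A_ii, the choice a = n, b = p + 1 gives 0 <= -n^2 (p + 2), which
     forces n = 0. *)
  rewrite qE mulr0; have := key _ _ n0 (addr_ge0 p0 ler01).
  move: n0; set n := A i j * _; rewrite qE => n0.
  have -> : n ^+ 2 * A i i - n * (A i i + 1) * n *+ 2 + (A i i + 1) ^+ 2 * n * 0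
    = - (n ^+ 2 * (A i i + 2)) by ring.
  rewrite oppr_ge0 pmulr_lle0 ?ltr_wpDl// => h.
  by rewrite -(ler_pXn2r (ltn0Sn 1)) ?nnegrE// expr0n.
have q_gt0 : 0 < A j j by rewrite lt_def q_neq0.
(* With q = A_jj, the choice a = q, b = 1 gives 0 <= q (p q - n), and q > 0 cancels. *)
have := key _ _ q0 ler01.
set n := A i j * _.
have -> : A j j ^+ 2 * A i i - A j j * 1 * n *+ 2 + 1 ^+ 2 * n * A j j
  = A j j * (A i i * A j j - n) by ring.
by rewrite pmulr_rge0// subr_ge0.
Qed.

Lemma psd_trace_ge0 A : psd A -> 0 <= \tr A.
Proof. by move=> pA; apply: sumr_ge0 => i _; exact: psd_diag_ge0. Qed.

(** Both sides are double sums, of A_ij A_ji and of A_ii A_jj, and the minors of order 2 compare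
    them term by term, without eigenvalues. *)
Lemma psd_trace_sqr_le A : psd A -> \tr (A *m A) <= \tr A ^+ 2.
Proof.
move=> pA; rewrite expr2 /mxtrace big_distrlr/=; apply: ler_sum => i _.
by rewrite mxE; apply: ler_sum => j _; exact: psd_minor2_le.
Qed.

Lemma psd_rank1 (v : 'cV[R[i]]_d) : psd (v *m v ^t*).
Proof.
split; first by apply/hermsymmxP; rewrite trmx_mul map_mxM trmxCK.
move=> w; rewrite mulmxA -mulmxA mxE big_ord1.
have -> : w ^t* *m v = (v ^t* *m w) ^t* by rewrite trmx_mul map_mxM trmxCK.
by rewrite !mxE mulrC mul_conjC_ge0.
Qed.

Lemma quad_form_hs A (v : 'cV[R[i]]_d) :
  (v ^t* *m A *m v) 0 0 = hs_inner A (v *m v ^t*).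
Proof.
have /hermsymmxP pE := (psd_rank1 v).1.
by rewrite /hs_inner pE mulmxA [RHS]mxtrace_mulC mulmxA /mxtrace big_ord1.
Qed.

End Psd.

(** * Real coordinates in a Hermitian basis *)

Section Coordinates.
Context (R : realType) (d : nat) (G : 'I_(1 + (d ^ 2 - 1)) -> 'M[R[i]]_d)
  (hG : hermitian_basis G).

Lemma hs_inner_suml (c : 'I_(1 + (d ^ 2 - 1)) -> R[i]) b :
  hs_inner (\sum_a c a *: G a) (G b) = c b.
Proof.
rewrite /hs_inner mulmx_suml linear_sum (bigD1 b)//= big1 => [|a ab].
  by rewrite addr0 -scalemxAl linearZ/= [\tr _]hb_orthonormal// eqxx mulr1.
by rewrite -scalemxAl linearZ/= [\tr _]hb_orthonormal// (negPf ab) mulr0.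
Qed.

Lemma hs_inner_real_sumr A (y : 'I_(1 + (d ^ 2 - 1)) -> R) :
  hs_inner A (\sum_a (y a)%:C *: G a) = \sum_a (y a)%:C * hs_inner A (G a).
Proof.
rewrite /hs_inner linear_sum/= raddf_sum mulmx_sumr linear_sum.
apply: eq_bigr => a _.
rewrite [(_ *: _)^T]linearZ/= map_mxZ -scalemxAr linearZ/=; congr (_ * _).
exact: conjc_real.
Qed.

Lemma hs_inner_real (x y : 'I_(1 + (d ^ 2 - 1)) -> R) :
  hs_inner (\sum_a (x a)%:C *: G a) (\sum_a (y a)%:C *: G a) =
  (\sum_a x a * y a)%:C.
Proof.
rewrite hs_inner_real_sumr rmorph_sum/=; apply: eq_bigr => a _.
by rewrite hs_inner_suml rmorphM mulrC.
Qed.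

Lemma hermsymmx_coord A : A \is hermsymmx ->
  A = \sum_a (complex.Re (hs_inner A (G a)))%:C *: G a.
Proof.
move=> hA.
have [c cE] : exists c, A = \sum_a c a *: G a.
  have := coord_basis (hb_basis hG) (memvf A).
  set X := [tuple G a | a < _] => E.
  exists (fun a => coord X a A); rewrite {1}E; apply: eq_bigr => a _.
  by rewrite -tnth_nth tnth_mktuple.
rewrite {1}cE; apply: eq_bigr => a _; congr (_ *: _).
rewrite RRe_real ?cE ?hs_inner_suml// -(hs_inner_suml c a) -cE.
(* The coefficient is real: since [A] and [G a] are Hermitian, conjugation turns the trace of
   [A *m G a] into that of [G a *m A], which is the same. *)
apply/CrealP; rewrite /hs_inner.
have /hermsymmxP -> := hb_hermitian hG a.
rewrite -trace_map_mx -mxtrace_tr map_trmx trmx_mul map_mxM.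
have /hermsymmxP -> := hA; have /hermsymmxP -> := hb_hermitian hG a.
exact: mxtrace_mulC.
Qed.

Lemma psd_coord A : (0 < d)%N -> psd A ->
  exists (x0 : R) (x : 'cV[R]_(d ^ 2 - 1)),
    [/\ A = \sum_a (col_mx x0%:M x a 0)%:C *: G a, 0 <= x0
      & enorm x <= Num.sqrt (d%:R - 1) * x0].
Proof.
move=> d_gt0 pA; have hA := pA.1.
pose r : 'cV[R]_(1 + (d ^ 2 - 1)) := \col_a complex.Re (hs_inner A (G a)).
have AE : A = \sum_a (r a 0)%:C *: G a.
  by rewrite {1}(hermsymmx_coord A hA); apply: eq_bigr => a _; rewrite mxE.
(* This is the pairing of [A] with [G ord0], the identity divided by the square root of d. *)
have r0E : (r ord0 0)%:C = \tr A / sqrtC d%:R.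
  rewrite -(hs_inner_suml (fun a => (r a 0)%:C)) -AE /hs_inner hb_id//.
  rewrite [(_ *: _)^T]linearZ/= map_mxZ/= trmx1 map_mx1 -scalemxAr mulmx1 linearZ/= mulrC.
  congr (_ * _); apply/CrealP/ger0_real.
  by rewrite invr_ge0 sqrtC_ge0.
have r0_ge0 : 0 <= r ord0 0.
  by rewrite -ler0c r0E divr_ge0 ?psd_trace_ge0// sqrtC_ge0.
(* By Parseval the left side is Tr(A^2), and by [r0E] the right side is (Tr A)^2. *)
have r_le : \sum_a r a 0 ^+ 2 <= d%:R * r ord0 0 ^+ 2.
  rewrite -lecR (_ : _%:C = \tr (A *m A)); last first.
    have /hermsymmxP E := hA; rewrite -{2}E -/(hs_inner A A) {1 2}AE.
    by rewrite hs_inner_real; congr (_%:C); apply: eq_bigr => a _.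
  apply: le_trans (psd_trace_sqr_le _ _ A pA) _.
  rewrite rmorphM rmorphXn/= r0E rmorph_nat expr_div_n sqrtCK mulrC divfK//.
  by rewrite pnatr_eq0 -lt0n.
exists (r ord0 0), (dsubmx r); split=> //.
  rewrite {1}AE; apply: eq_bigr => a _; congr (_%:C *: _).
  rewrite -{1}(vsubmxK r); congr (col_mx _ _ _ _).
  apply/matrixP => i j; rewrite !ord1 !mxE eqxx mulr1n.
  by congr (complex.Re (hs_inner A (G _))); apply: val_inj.
have d1 : 0 <= d%:R - 1 :> R by rewrite subr_ge0 ler1n.
(* After squaring, the bound reads x0^2 + |x|^2 <= d x0^2, which is [r_le] with the index 0 split
   off; hence the factor d - 1. *)
rewrite -ler_sqr ?nnegrE ?mulr_ge0 ?enorm_ge0 ?sqrtr_ge0//.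
rewrite exprMn sqr_enorm sqr_sqrtr// mulrBl mul1r lerBrDl.
apply: le_trans r_le; rewrite big_split_ord/= big_ord1.
rewrite (_ : lshift _ ord0 = ord0 :> 'I_(1 + _)); last exact: val_inj.
by rewrite lerD2l; apply: ler_sum => i _; rewrite [dsubmx _ _ _]mxE.
Qed.

End Coordinates.

(** * Positivity of the map *)

Theorem theorem1 (R : realType) (d1 d2 : nat) (d1_gt0 : (0 < d1)%N)
  (d2_gt0 : (0 < d2)%N)
  (Gamma : 'I_(1 + (d1 ^ 2 - 1)) -> 'M[R[i]]_d1)
  (Omega : 'I_(1 + (d2 ^ 2 - 1)) -> 'M[R[i]]_d2)
  (Gamma_basis : hermitian_basis Gamma)
  (Omega_basis : hermitian_basis Omega)
  (Phi : {linear 'M[R[i]]_d1 -> 'M[R[i]]_d2})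
  (M : 'M[R]_(1 + (d2 ^ 2 - 1), 1 + (d1 ^ 2 - 1)))
  (Phi_M : forall a, Phi (Gamma a) = \sum_b (M b a)%:C *: Omega b)
  (R00 : R) (s : 'rV[R]_(d1 ^ 2 - 1)) (t : 'cV[R]_(d2 ^ 2 - 1))
  (Lambda : 'M[R]_(d2 ^ 2 - 1, d1 ^ 2 - 1))
  (M_block : M = block_mx R00%:M s t Lambda)
  (bound : Num.sqrt (d2%:R - 1) * enorm t + Num.sqrt (d1%:R - 1) * enorm s^T
           + Num.sqrt ((d1%:R - 1) * (d2%:R - 1)) * opnorm Lambda <= R00) :
  positive_map Phi.
Proof.
move=> A /(psd_coord _ _ _ Gamma_basis _ d1_gt0)[x0 [x [AE x0_ge0 x_le]]].
have PhiE : Phi A = \sum_b ((M *m col_mx x0%:M x) b 0)%:C *: Omega b.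
  rewrite AE linear_sum.
  under eq_bigr do rewrite linearZ/= Phi_M scaler_sumr.
  rewrite exchange_big/=; apply: eq_bigr => b _.
  rewrite [in RHS]mxE rmorph_sum scaler_suml; apply: eq_bigr => a _.
  by rewrite scalerA rmorphM mulrC.
split.
  (* A combination of Hermitian operators with real coefficients is Hermitian. *)
  rewrite PhiE; apply/hermsymmxP; rewrite raddf_sum raddf_sum/=.
  apply: eq_bigr => b _; rewrite [(_ *: _)^T]linearZ/= map_mxZ/=.
  have /hermsymmxP -> := hb_hermitian Omega_basis b.
  by congr (_ *: _); exact: conjc_real.
move=> v; rewrite quad_form_hs PhiE.
have [y0 [y [-> y0_ge0 y_le]]] :=
  psd_coord _ _ _ Omega_basis _ d2_gt0 (psd_rank1 _ _ v).
(* The goal is now a real inner product of coordinate vectors, that of M (x0, x) with (y0, y); the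
   block form of M splits it into the terms of [block_form_ge0]. *)
rewrite hs_inner_real// ler0c M_block mul_block_col.
rewrite big_split_ord/= big_ord1 !col_mxEu.
under eq_bigr do rewrite !col_mxEd mulrC.
have d1_ge0 : 0 <= d1%:R - 1 :> R by rewrite subr_ge0 ler1n.
have -> : \sum_i y i 0 * (t *m x0%:M + Lambda *m x) i 0 =
    (y^T *m t) 0 0 * x0 + (y^T *m (Lambda *m x)) 0 0.
  transitivity ((y^T *m (t *m x0%:M + Lambda *m x)) 0 0).
    by rewrite [RHS]mxE; apply: eq_bigr => i _; rewrite [_^T _ _]mxE.
  by rewrite mulmxDr mul_mx_scalar -scalemxAr !mxE [_ * x0]mulrC.
have -> : (R00%:M *m x0%:M + s *m x) ord0 0 * (y0%:M : 'M_1) ord0 0 =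
    y0 * (R00 * x0 + (s *m x) 0 0).
  rewrite [LHS]mulrC -scalar_mxM; congr (_ * _); rewrite mxE ?eqxx ?mulr1n//.
  by congr (_ + _); rewrite mxE eqxx mulr1n.
(* Splitting the root gives the third term the form a b |Lambda|, with a and b the roots of d1 - 1
   and d2 - 1. *)
rewrite sqrtrM// in bound.
have := block_form_ge0 _ _ _ _ _ R00 s^T t Lambda x0 y0 x y
  (sqrtr_ge0 _) (sqrtr_ge0 _) x0_ge0 y0_ge0 x_le y_le bound.
by rewrite trmxK.
Qed.
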